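(* Let $G=C_{n_1}\oplus C_{n_2}$ with $1<n_1\mid n_2$ and let $A$ be a separating atom (over $\mathrm{supp}(A)\subseteq G$) with $|A|=\beta_{\mathrm{sep}}(G)$ and $|\mathrm{supp}(A)|\le 3$. Then there exist three elements $g_1,g_2,g_3\in G$ with $\mathrm{ord}(g_1)=\mathrm{ord}(g_2)=n_2$ and $\mathrm{ord}(g_3)=n_1$ such that $\mathrm{supp}(A)=\{g_1,g_2,g_3\}$ and $g_i\notin\langle g_j\rangle$ for any two distinct indices $i,j\in\{1,2,3\}$.
   Context: $C_n$ is the cyclic group of order $n$; $G$ is written additively. Sequences. For $G_0\subseteq G$, a sequence over $G_0$ is an element $S=\prod_{g\in G_0}g^{\mathsf v_g(S)}$ of the multiplicatively written free abelian monoid $\mathcal F(G_0)$ with basis $G_0$; its length is $|S|=\sum_g \mathsf v_g(S)$, its support is $\mathrm{supp}(S)=\{g:\mathsf v_g(S)\neq 0\}$, its sum is $\sigma(S)=\sum_g\mathsf v_g(S)g\in G$. $\mathcal B(G_0)=\{S\in\mathcal F(G_0):\sigma(S)=0\}$ is the monoid of zero-sum sequences over $G_0$. $\mathcal A(G_0)$ is the set of its atoms, i.e. minimal zero-sum sequences (nontrivial zero-sum sequences with no proper nontrivial zero-sum subsequence). For $\ell\in\mathbb N_0$, $\mathcal B(G_0)_\ell$ is the submonoid of $\mathcal B(G_0)$ generated by the atoms $A\in\mathcal A(G_0)$ with $|A|\le\ell$. $\mathsf q(H)$ denotes the quotient group of a monoid $H$ (for submonoids of $\mathcal F(G_0)$,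 the subgroup generated inside the free abelian group $\mathsf q(\mathcal F(G_0))$). A separating atom over $G_0$ is an $A\in\mathcal A(G_0)$ with $A\notin\mathsf q(\mathcal B(G_0)_{|A|-1})$. One says simply that $A$ is a separating atom if $A$ is a separating atom over $\mathrm{supp}(A)$. Separating Noether number. For a finite dimensional $\mathbb{C}G$-module $V$, $G$ acts on $\mathbb{C}[V]$ by $(g\cdot f)(v)=f(g^{-1}\cdot v)$, with invariant algebra $\mathbb{C}[V]^G$. A subset $S\subseteq\mathbb{C}[V]^G$ is separating if whenever $v_1,v_2\in V$ satisfy $h(v_1)\ne h(v_2)$ for some $h\in\mathbb{C}[V]^G$, there is $f\in S$ with $f(v_1)\neq f(v_2)$. $\beta_{\mathrm{sep}}(G,V)$ is the minimal positive integer $d$ such that $\mathbb{C}[V]^G$ contains a separating set of homogeneous polynomials of degree at most $d$, and $\beta_{\mathrm{sep}}(G)=\sup_V\beta_{\mathrm{sep}}(G,V)$ over all finite dimensional $\mathbb{C}G$-modules $V$. *)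

(* Defs.v *)
From HB Require Import structures.
From mathcomp Require Import all_boot all_order all_algebra all_fingroup.
From mathcomp Require Import all_solvable all_character.
From mathcomp Require Import mpoly complex reals.

Set Implicit Arguments.
Unset Strict Implicit.
Unset Printing Implicit Defensive.

Import GRing.Theory.

Local Open Scope ring_scope.

(* A sequence S over the finite abelian group G is its multiplicity function
   g |-> v_g(S); the free abelian monoid F(G) is {ffun G -> nat}, written
   additively here, and its quotient group is {ffun G -> int}. *)
Notation sequence G := {ffun G -> nat}.

Section Sequences.
Variable G : finZmodType.
Implicit Types (S T A : sequence G) (X : {set G}).

Definition seq_length S : nat := (\sum_(g : G) S g)%N.

Definition seq_supp S : {set G} := [set g | S g != 0%N].

Definition seq_sum S : G := \sum_(g : G) g *+ S g.

Definition subsequence T S : Prop := forall g, (T g <= S g)%N.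

Definition zero_sum X S : Prop := seq_supp S \subset X /\ seq_sum S = 0.

Definition atom X A : Prop :=
  [/\ zero_sum X A, A <> 0 &
      forall T, subsequence T A -> zero_sum X T -> T <> 0 -> T = A].

Inductive submonoid_gen (P : sequence G -> Prop) : sequence G -> Prop :=
| submonoid_gen0 : submonoid_gen P 0
| submonoid_gen_base S : P S -> submonoid_gen P S
| submonoid_genD S T :
    submonoid_gen P S -> submonoid_gen P T -> submonoid_gen P (S + T).

Definition zero_sum_upto X (l : nat) : sequence G -> Prop :=
  submonoid_gen (fun A => atom X A /\ (seq_length A <= l)%N).

Definition seq_to_int S : {ffun G -> int} := [ffun g => (S g)%:Z].

Inductive quotient_group (H : sequence G -> Prop) : {ffun G -> int} -> Prop :=
| quotient_group0 : quotient_group H 0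
| quotient_group_base S : H S -> quotient_group H (seq_to_int S)
| quotient_groupB x y :
    quotient_group H x -> quotient_group H y -> quotient_group H (x - y).

Definition separating_atom_over X A : Prop :=
  atom X A /\
  ~ quotient_group (zero_sum_upto X (seq_length A).-1) (seq_to_int A).

Definition separating_atom A : Prop := separating_atom_over (seq_supp A) A.

End Sequences.

(* Up to isomorphism a finite dimensional CG-module is C^n (column vectors)
   with G acting through a matrix representation rho; its coordinate ring is
   then {mpoly C[n]}.  The group operations of [set: G] are the additive ones
   of G.  The field C of complex numbers is R[i], for R the real numbers. *)
Section SeparatingNoether.
Variables (R : realType) (G : finZmodType).

Section Module.
Variables (n : nat) (rho : mx_representation R[i] [set: G] n).
Implicit Types (f h : {mpoly R[i][n]}) (v : 'cV[R[i]]_n).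

Definition poly_eval f v : R[i] := f.@[fun i => v i 0].

(* (g . f)(v) = f(g^-1 v); as C is infinite, g . f = f may be tested on
   points. *)
Definition invariant f : Prop :=
  forall (g : G) v, poly_eval f (rho (- g) *m v) = poly_eval f v.

Definition separating (F : {mpoly R[i][n]} -> Prop) : Prop :=
  (forall f, F f -> invariant f) /\
  forall v1 v2,
    (exists h, invariant h /\ poly_eval h v1 <> poly_eval h v2) ->
    exists f, F f /\ poly_eval f v1 <> poly_eval f v2.

Definition separating_in_degree (d : nat) : Prop :=
  exists F : {mpoly R[i][n]} -> Prop,
    separating F /\
    forall f, F f -> exists k : nat, (k <= d)%N /\ f \is k.-homog.

Definition is_beta_sep_module (d : nat) : Prop :=
  [/\ (0 < d)%N, separating_in_degree d &
      forall d' : nat, (0 < d')%N -> separating_in_degree d' -> (d <= d')%N].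

End Module.

Definition beta_sep_bound (m : nat) : Prop :=
  forall n (rho : mx_representation R[i] [set: G] n),
    exists d : nat, is_beta_sep_module rho d /\ (d <= m)%N.

(* m = beta_sep(G), the supremum of beta_sep(G, V) over all V. *)
Definition is_beta_sep (m : nat) : Prop :=
  beta_sep_bound m /\ forall m' : nat, beta_sep_bound m' -> (m <= m')%N.

End SeparatingNoether.

(* Main.v *)
Require Import Defs.
From mathcomp Require Import all_boot all_order all_algebra all_fingroup.
From mathcomp Require Import all_solvable all_field all_character.
From mathcomp Require Import mpoly complex boolp reals.
From mathcomp Require Import zify ring.

(* Write D = |A| and let Q be the group generated by the zero-sum sequences over
   supp(A) = {g1, g2, g3} of length < D; thus A lies outside Q.

   Lower bound.  Let p be the least prime divisor of n1, and let G act on C^3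
   through the characters e2^*, e1^* and e2^* - (n1/p) e1^*, where e1^*, e2^*
   are the coordinate characters of G.  An invariant monomial x^a y^b z^c of
   degree < n2 + n1/p has p | c, so the points (1,1,1) and (1,1,w), w a primitive
   p-th root of unity, are only separated in degree >= n2 + n1/p, e.g. by
   x^(n2-1) y^(n1/p) z.  Hence D >= n2 + n1/p.

   Orders.  A relation i g1 + j g2 + k g3 = 0 with a zero coordinate lies in Q:
   reducing its two other coordinates modulo n2, either it or its negative has
   length <= n2 < D.  Hence g_i is not in <g_j>.  A relation outside Q, reduced
   modulo the orders o1, o2, o3, has length >= D, and so has its negative, so
   o1 + o2 + o3 >= 2D > 2 n2; as each o_i divides n2, two of them, say o1 and o2,
   equal n2, and then o3 >= 2 n1/p.  If n1 g3 = 0 then o3 = n1, because n1/o3 is a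
   divisor of n1 that is at most p/2.

   n1 g3 = 0.  Suppose N = n2/n1 > 1.  There is a relation outside Q whose third
   coordinate t is the order of g3 modulo <g1, g2>, and t <= n1/p.  Since n1 G is
   generated by n1 g1 as well as by n1 g2, it can be moved modulo Q to
   (r1 + n1 a, r2 + n1 b, t) with 0 <= r1, r2 < n1, any a < N and some b < N, and
   its length forces a + b >= N - 1.  Taking a = 0 and a = 1 yields
   n1 g1 = n1 g2.  Write n1 g3 = - y n1 g2 with 0 <= y < N; if y > 0, then
     (r1, r2 + n1 (y-1), t + n1) and (n1 - r1, n1 - r2 + n1 (y-1), n1 - t)
   are relations outside Q of total length 2 n1 (y + 1) <= 2 n2 < 2D. *)

Set Implicit Arguments.
Unset Strict Implicit.
Unset Printing Implicit Defensive.

Import GRing.Theory Num.Theory FinRing.Theory.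

Local Open Scope ring_scope.

(** * Relations between three elements *)

Definition is_relation (G : zmodType) (g1 g2 g3 : G) (i j k : int) : Prop :=
  g1 *~ i + g2 *~ j + g3 *~ k = 0.

(* P plays the role of Q, pulled back to Z^3; g1, g2, g3 need not be distinct. *)
Record separates_short (G : zmodType) (D : nat) (g1 g2 g3 : G)
    (P : int -> int -> int -> Prop) : Prop := SeparatesShort {
  ss_sub : forall i j k i' j' k',
    P i j k -> P i' j' k' -> P (i - i') (j - j') (k - k');
  ss_short : forall i j k : nat,
    is_relation g1 g2 g3 i j k -> (i + j + k < D)%N -> P i j k;
  ss_long : exists i j k, is_relation g1 g2 g3 i j k /\ ~ P i j k }.

(** Relations form a subgroup of Z^3. The target coordinates are variables tied by equations, so
    that each use leaves goals for [ring] or [lia]. *)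
Lemma relation_lin (G : zmodType) (g1 g2 g3 : G) (c i j k i' j' k' a b e : int) :
  is_relation g1 g2 g3 i j k -> is_relation g1 g2 g3 i' j' k' ->
  a = i + i' * c -> b = j + j' * c -> e = k + k' * c ->
  is_relation g1 g2 g3 a b e.
Proof.
rewrite /is_relation => r r' -> -> ->; rewrite -[RHS]r -[RHS]addr0.
rewrite -[X in _ = _ + X](mul0rz _ c) -r' !mulrzDl !mulrzDr !mulrzA.
by rewrite [RHS]addrACA (addrACA (g1 *~ i)).
Qed.

(** Together with the rotation below, this lets each later lemma be proved for one position of the
    elements only. *)
Lemma separates_short_swap (G : zmodType) D (g1 g2 g3 : G) P :
  separates_short D g1 g2 g3 P ->
  separates_short D g2 g1 g3 (fun i j k => P j i k).
Proof.
case=> sub short [i [j [k [rel nP]]]]; split=> [||].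
- by move=> *; apply: sub.
- move=> i1 j1 k1 r l; apply: short; last by rewrite (addnC j1).
  by rewrite /is_relation [g1 *~ _ + _]addrC.
- by exists j, i, k; split=> //; rewrite /is_relation [g2 *~ _ + _]addrC.
Qed.

Lemma separates_short_rot (G : zmodType) D (g1 g2 g3 : G) P :
  separates_short D g1 g2 g3 P ->
  separates_short D g2 g3 g1 (fun i j k => P k i j).
Proof.
case=> sub short [i [j [k [rel nP]]]]; split=> [||].
- by move=> *; apply: sub.
- move=> i1 j1 k1 r l; apply: short; last by rewrite -addnA addnC.
  by rewrite /is_relation -addrA [LHS]addrC.
- by exists j, k, i; split=> //; rewrite /is_relation [LHS]addrC addrA.
Qed.

Lemma int_mod_nat (n : nat) (i : int) : (0 < n)%N ->
  exists (r : nat) (q : int), (r < n)%N /\ i = r%:Z + n%:Z * q.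
Proof.
move=> n0; exists `|(i %% n)%Z|%N, (i %/ n)%Z.
have n0' : n%:Z != 0 by lia.
have := modz_ge0 i n0'; have := ltz_pmod i (d := n); have := divz_eq i n.
by move=> e h1 h2; split; first lia; rewrite gez0_abs // [LHS]e; ring.
Qed.

(** * Relations with a zero coordinate, and the sum of the three orders *)

Section ShortRelations.

Variables (G : finZmodType) (D : nat) (g1 g2 g3 : G) (P : int -> int -> int -> Prop).
Hypothesis sepP : separates_short D g1 g2 g3 P.

Let rel := is_relation g1 g2 g3.

(** Closure under subtraction already yields 0, sums and integer multiples; the form matches
    [relation_lin]. *)
Lemma separates_short_lin (c i j k i' j' k' a b e : int) :
  P i j k -> P i' j' k' ->
  a = i + i' * c -> b = j + j' * c -> e = k + k' * c -> P a b e.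
Proof.
move=> Px Py -> -> ->; have P0 : P 0 0 0.
  by have := ss_sub sepP Px Px; rewrite !subrr.
have addP x1 x2 x3 y1 y2 y3 :
    P x1 x2 x3 -> P y1 y2 y3 -> P (x1 + y1) (x2 + y2) (x3 + y3).
  move=> P1 P2; have := ss_sub sepP P1 (ss_sub sepP P0 P2).
  by rewrite !sub0r !opprK.
have scaleP (n : nat) : P (i' * n) (j' * n) (k' * n).
  elim: n => [|n IH]; first by rewrite !mulr0.
  by rewrite -addn1 PoszD !mulrDr !mulr1; apply: addP.
apply: addP => //; case: c => n; first exact: scaleP.
have := ss_sub sepP P0 (scaleP n.+1).
by rewrite !sub0r NegzE !mulrN.
Qed.

Lemma separates_short_long (i j k : nat) :
  rel i j k -> ~ P i j k -> (D <= i + j + k)%N.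
Proof. by move=> r nP; rewrite leqNgt; apply/negP => /(ss_short sepP r). Qed.

Variable n2 : nat.
Hypothesis exp_n2 : forall g : G, g *+ n2 = 0.
Hypothesis n2_gt0 : (0 < n2)%N.
Hypothesis n2_lt_D : (n2 < D)%N.

Lemma relation_zero3 (i j : int) : rel i j 0 -> P i j 0.
Proof.
move=> r; have [a [q [a_lt ea]]] := int_mod_nat i n2_gt0.
have [b [s [b_lt eb]]] := int_mod_nat j n2_gt0.
have R1 : rel n2 0 0 by rewrite /rel /is_relation !mulr0z !addr0 -pmulrn.
have R2 : rel 0 n2 0 by rewrite /rel /is_relation !mulr0z addr0 add0r -pmulrn.
have P1 : P n2 0 0 by apply: (ss_short sepP (j := 0) (k := 0)) => //; lia.
have P2 : P 0 n2 0 by apply: (ss_short sepP (i := 0) (k := 0)) => //; lia.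
have Ra : rel a j 0 by apply: (relation_lin (c := - q) r R1); rewrite ?ea; ring.
have Rab : rel a b 0 by apply: (relation_lin (c := - s) Ra R2); rewrite ?eb; ring.
suff Pab : P a b 0.
  have Paj : P a j 0 by apply: (separates_short_lin (c := s) Pab P2); rewrite ?eb; ring.
  by apply: (separates_short_lin (c := q) Paj P1); rewrite ?ea; ring.
have [ab_lt | ab_ge] := ltnP (a + b) D.
  by apply: (ss_short sepP (k := 0)) => //; lia.
have R3 : rel n2 n2 0 by apply: (relation_lin (c := 1) R1 R2); ring.
have P3 : P n2 n2 0 by apply: (separates_short_lin (c := 1) P1 P2); ring.
(* Here a + b >= D > n2, so the complement has length 2 n2 - (a + b) < n2 < D. *)
have Pc : P (n2 - a)%N (n2 - b)%N 0.
  apply: (ss_short sepP (k := 0)); last lia.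
  by apply: (relation_lin (c := -1) R3 Rab); lia.
by apply: (separates_short_lin (c := -1) P3 Pc); lia.
Qed.

Lemma sum_orders_ge : (2 * D <= #[g1]%g + #[g2]%g + #[g3]%g)%N.
Proof.
have [i [j [k [r nP]]]] := ss_long sepP.
have [a [q [a_lt ea]]] := int_mod_nat i (order_gt0 g1).
have [b [s [b_lt eb]]] := int_mod_nat j (order_gt0 g2).
have [e [t [e_lt ee]]] := int_mod_nat k (order_gt0 g3).
have ord_lt (g : G) : (#[g]%g < D)%N.
  by apply: leq_ltn_trans n2_lt_D; rewrite dvdn_leq // order_dvdn zmodXgE exp_n2.
have ordK (g : G) : g *~ #[g]%g = 0 by rewrite -pmulrn -zmodXgE expg_order.
have R1 : rel #[g1]%g 0 0 by rewrite /rel /is_relation !mulr0z !addr0 ordK.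
have R2 : rel 0 #[g2]%g 0 by rewrite /rel /is_relation !mulr0z addr0 add0r ordK.
have R3 : rel 0 0 #[g3]%g by rewrite /rel /is_relation !mulr0z !add0r ordK.
have P1 : P #[g1]%g 0 0.
  by apply: (ss_short sepP (j := 0) (k := 0)) R1 _; rewrite !addn0 ord_lt.
have P2 : P 0 #[g2]%g 0.
  by apply: (ss_short sepP (i := 0) (k := 0)) R2 _; rewrite addn0 add0n ord_lt.
have P3 : P 0 0 #[g3]%g.
  by apply: (ss_short sepP (i := 0) (j := 0)) R3 _; apply: ord_lt.
have Ra : rel a j k by apply: (relation_lin (c := - q) r R1); rewrite ?ea; ring.
have Rb : rel a b k by apply: (relation_lin (c := - s) Ra R2); rewrite ?eb; ring.
have Re : rel a b e by apply: (relation_lin (c := - t) Rb R3); rewrite ?ee; ring.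
have nPe : ~ P a b e.
  move=> Pe; apply: nP.
  have Pb : P a b k by apply: (separates_short_lin (c := t) Pe P3); rewrite ?ee; ring.
  have Pa : P a j k by apply: (separates_short_lin (c := s) Pb P2); rewrite ?eb; ring.
  by apply: (separates_short_lin (c := q) Pa P1); rewrite ?ea; ring.
have := separates_short_long Re nPe.
have R12 : rel #[g1]%g #[g2]%g 0 by apply: (relation_lin (c := 1) R1 R2); ring.
have Rs : rel #[g1]%g #[g2]%g #[g3]%g by apply: (relation_lin (c := 1) R12 R3); ring.
have P12 : P #[g1]%g #[g2]%g 0 by apply: (separates_short_lin (c := 1) P1 P2); ring.
have Ps : P #[g1]%g #[g2]%g #[g3]%g by apply: (separates_short_lin (c := 1) P12 P3); ring.
(* The complement of the reduced relation is outside [P] too, and the two lengths add up to the sum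
   of the orders. *)
have Rn : rel (#[g1]%g - a)%N (#[g2]%g - b)%N (#[g3]%g - e)%N.
  by apply: (relation_lin (c := -1) Rs Re); lia.
have nPn : ~ P (#[g1]%g - a)%N (#[g2]%g - b)%N (#[g3]%g - e)%N.
  by move=> Pn; apply: nPe; apply: (separates_short_lin (c := -1) Ps Pn); lia.
have := separates_short_long Rn nPn.
by lia.
Qed.

End ShortRelations.

(** * Independence of the elements, and the third order when the first two are n2 *)

Section MaximalOrders.

Variables (G : finZmodType) (D : nat) (g1 g2 g3 : G) (P : int -> int -> int -> Prop).
Hypothesis sepP : separates_short D g1 g2 g3 P.

Let rel := is_relation g1 g2 g3.
Variable n2 : nat.
Hypothesis exp_n2 : forall g : G, g *+ n2 = 0.
Hypothesis n2_gt0 : (0 < n2)%N.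
Hypothesis n2_lt_D : (n2 < D)%N.

Lemma relation_zero1 (j k : int) : rel 0 j k -> P 0 j k.
Proof.
move=> r; apply: (relation_zero3 (separates_short_rot sepP) exp_n2) => //.
by rewrite /is_relation [LHS]addrC addrA.
Qed.

(** If g1 = m g2, then (1, -m, 0) is in [P], and subtracting a multiple of it clears the first
    coordinate of any relation; so [P] would contain all relations. *)
Lemma notin_cycle12 : g1 \notin <[g2]>%g.
Proof.
apply/negP => /cycleP[m]; rewrite zmodXgE => e.
have [i [j [k [r nP]]]] := ss_long sepP.
have R1 : rel 1 (- m%:Z) 0.
  by rewrite /rel /is_relation mulr0z addr0 mulr1z mulrNz -pmulrn e subrr.
have P1 := relation_zero3 sepP exp_n2 n2_gt0 n2_lt_D R1; apply: nP.
suff P2 : P 0 (j + i * m%:Z) k by apply: (separates_short_lin sepP (c := i) P2 P1); ring.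
apply: relation_zero1.
by apply: (relation_lin (c := - i) r R1); ring.
Qed.

Variable n1 : nat.
Hypothesis n1_gt1 : (1 < n1)%N.
Hypothesis n1_dvd_n2 : (n1 %| n2)%N.
Hypothesis cardG : #|G| = (n1 * n2)%N.
Hypothesis ord_g1 : #[g1]%g = n2.
Hypothesis ord_g2 : #[g2]%g = n2.

Let p := pdiv n1.
Hypothesis D_ge : (n2 + n1 %/ p <= D)%N.

(** The witness [t] is the order of g3 modulo H = <g1, g2>. It divides the third coordinate of every
    relation, so if a relation ending in [t] were in [P], all relations would be, by
    [relation_zero3]. *)
Lemma nonshort_relation3 : g2 \notin <[g1]>%g ->
  exists (i j : int) (t : nat),
    [/\ (0 < t <= n1 %/ p)%N, rel i j t & ~ P i j t].
Proof.
move=> g2g1; have abG : abelian [set: G] by apply: zmod_abelian.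
pose H := (<[g1]> <*> <[g2]>)%G.
have HE : H = (<[g1]> * <[g2]>)%g :> {set G}.
  by rewrite /= cent_joinEr // (sub_abelian_cent2 abG) ?subsetT.
have g1_H : g1 \in H by apply: (subsetP (joing_subl _ _)); apply: cycle_id.
have g2_H : g2 \in H by apply: (subsetP (joing_subr _ _)); apply: cycle_id.
have nH g : g \in 'N(H)%g.
  by apply: (subsetP (sub_abelian_norm abG (subsetT H))); rewrite inE.
pose t := #[coset H g3]%g.
have t_multiple (k : int) i j : rel i j k -> (t%:Z %| k)%Z.
  move=> r.
  have mulH (g : G) (m : int) : g \in H -> g *~ m \in H.
    by case: m => m gH; rewrite ?NegzE ?mulrNz -pmulrn -zmodXgE ?groupV ?groupX.
  have kH : g3 *~ k \in H.
    have -> : g3 *~ k = - (g1 *~ i + g2 *~ j) by apply/eqP; rewrite -addr_eq0 addrC r.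
    by rewrite groupV groupM ?mulH.
  have kH' : g3 *+ `|k|%N \in H.
    by case: k kH {r} => m; rewrite ?NegzE ?mulrNz -pmulrn ?groupV.
  rewrite dvdzE /= order_dvdn -morphX ?nH //=; apply/eqP/coset_id.
  by rewrite zmodXgE.
have tH : g3 *+ t \in H.
  by rewrite -zmodXgE; apply: coset_idr => //; rewrite morphX ?nH // expg_order.
have [a1 [a2 ra]] : exists a1 a2 : int, rel a1 a2 t.
  move: tH; rewrite HE => /mulsgP[_ _ /cycleP[b1 ->] /cycleP[b2 ->]].
  rewrite !zmodXgE zmodMgE => e; exists (- b1%:Z), (- b2%:Z).
  by rewrite /rel /is_relation !mulrNz -!pmulrn e -opprD addNr.
have [i [j [k [r nP]]]] := ss_long sepP.
have /dvdzP[c ec] := t_multiple _ _ _ r.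
exists a1, a2, t; split=> //; last first.
  move=> Pa; apply: nP.
  suff P0 : P (i - a1 * c) (j - a2 * c) 0.
    by apply: (separates_short_lin sepP (c := c) P0 Pa); rewrite ?ec; ring.
  apply: (relation_zero3 sepP exp_n2) => //.
  by apply: (relation_lin (c := - c) r ra); rewrite ?ec; ring.
rewrite order_gt0 /=.
have t_dvd : (t %| #|[set: G] : H|%g)%N.
  rewrite -card_quotient; last by apply/subsetP=> g _; apply: nH.
  by apply: order_dvdG; rewrite mem_quotient ?inE.
have g1H : (<[g1]> \subset H)%g by rewrite joing_subl.
have u_gt1 : (1 < #|H : <[g1]>|%g)%N.
  rewrite indexg_gt1; apply: contra g2g1 => /subsetP; exact.
(* By Lagrange, as g1 has order n2. The index of <g1> in H is a divisor of n1 greater than 1, hence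
   at least p, which leaves at most n1/p for the index of H in G. *)
have e : (#|H : <[g1]>|%g * #|[set: G] : H|%g)%N = n1.
  have := Lagrange (subsetT H); rewrite -(Lagrange g1H) cardsT cardG.
  rewrite -orderE ord_g1 -mulnA mulnC => /eqP.
  by rewrite eqn_pmul2r // => /eqP.
apply: leq_trans (dvdn_leq _ t_dvd) _; first exact: indexg_gt0.
rewrite leq_divRL ?pdiv_gt0 // -[leqRHS]e mulnC leq_mul2r.
by rewrite (pdiv_min_dvd u_gt1) ?orbT // -e dvdn_mulr.
Qed.

Hypothesis n1_mul_cyclic : forall g h : G, #[g]%g = n2 ->
  exists m : int, h *~ n1 = g *~ (n1%:Z * m).

Lemma n1_mul_g3_eq0 : g2 \notin <[g1]>%g -> g3 *+ n1 = 0.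
Proof.
move=> g2g1; have [N n2E] := dvdnP n1_dvd_n2.
have n1_gt0 : (0 < n1)%N by lia.
have [N_le1 | N_gt1] := leqP N 1.
  have N1 : N = 1%N by case: N n2E N_le1 => [|[|]] //; lia.
  by rewrite -(exp_n2 g3) n2E N1 mul1n.
have [i [j [t [/andP[t_gt0 t_le] r nP]]]] := nonshort_relation3 g2g1.
have t_lt : (t <= n1)%N := leq_trans t_le (leq_div _ _).
have [r1 [q1 [r1_lt ei]]] := int_mod_nat i n1_gt0.
have [r2 [q2 [r2_lt ej]]] := int_mod_nat j n1_gt0.
have R2 : rel 0 n2 0 by rewrite /rel /is_relation !mulr0z addr0 add0r -pmulrn.
have P2 : P 0 n2 0 by apply: (relation_zero3 sepP exp_n2).
(* Adding a multiple of (n1, - n1 m, 0), which lies in [P], makes [a] arbitrary; [b] is then reduced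
   modulo N by means of (0, n2, 0). *)
have coset_rep (a : nat) : exists b : nat,
    [/\ (b < N)%N, rel (r1 + n1 * a)%N (r2 + n1 * b)%N t
      & ~ P (r1 + n1 * a)%N (r2 + n1 * b)%N t].
  have [m em] := n1_mul_cyclic g1 ord_g2.
  have Rm : rel n1 (- (n1%:Z * m)) 0.
    by rewrite /rel /is_relation mulr0z addr0 em mulrNz subrr.
  have Pm : P n1 (- (n1%:Z * m)) 0 by apply: (relation_zero3 sepP exp_n2).
  have [b [s [b_lt eb]]] := int_mod_nat (q2 - (a%:Z - q1) * m) (ltnW N_gt1).
  pose B : int := r2%:Z + n1%:Z * (q2 - (a%:Z - q1) * m).
  exists b; split=> //.
    have Ra : rel (r1 + n1 * a)%N B t.
      by apply: (relation_lin (c := a%:Z - q1) r Rm); rewrite ?ei ?ej /B ?PoszD ?PoszM; ring.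
    apply: (relation_lin (c := - s) Ra R2); rewrite /B ?eb ?n2E ?PoszD ?PoszM; ring.
  move=> Pb; apply: nP.
  have Pa : P (r1 + n1 * a)%N B t.
    by apply: (separates_short_lin sepP (c := s) Pb P2); rewrite /B ?eb ?n2E ?PoszD ?PoszM; ring.
  apply: (separates_short_lin sepP (c := q1 - a%:Z) Pa Pm);
    by rewrite ?ei ?ej /B ?PoszD ?PoszM; ring.
(* Since t <= n1/p, the bound D >= n2 + n1/p leaves n1 N <= r1 + r2 + n1 (a + b) < n1 (a + b +
   2). *)
have coset_rep_ge (a b : nat) : rel (r1 + n1 * a)%N (r2 + n1 * b)%N t ->
    ~ P (r1 + n1 * a)%N (r2 + n1 * b)%N t -> (N <= a + b + 1)%N.
  move=> Rab nPab; have := separates_short_long sepP Rab nPab.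
  have : (n1 * N < n1 * (a + b + 2) -> N < a + b + 2)%N by rewrite ltn_pmul2l.
  rewrite !mulnDr; lia.
have [b0 [b0_lt Rx nPx]] := coset_rep 0.
have b0E : b0 = N.-1 by have := coset_rep_ge _ _ Rx nPx; lia.
have [b1 [b1_lt Rx1 nPx1]] := coset_rep 1.
(* The bounds leave b1 = N - 1 or b1 = N - 2. Subtracting the two representatives gives n1 g1 = 0 in
   the first case, impossible as g1 has order n2 > n1, and n1 g1 = n1 g2 in the second. *)
have R11 : rel n1 (- n1%:Z) 0.
  have b1_ge := coset_rep_ge _ _ Rx1 nPx1.
  have [b1E | b1E] : b1 = b0 \/ (b1.+1 = b0)%N by lia.
    have : rel n1 0 0.
      by apply: (relation_lin (c := -1) Rx1 Rx); rewrite ?b1E ?PoszD ?PoszM; ring.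
    rewrite /rel /is_relation !mulr0z !addr0 -pmulrn -zmodXgE => /eqP.
    by rewrite -order_dvdn ord_g1 => /dvdn_leq; nia.
  by apply: (relation_lin (c := -1) Rx1 Rx); rewrite -?b1E -?(addn1 b1) ?PoszD ?PoszM; ring.
have P11 : P n1 (- n1%:Z) 0 by apply: (relation_zero3 sepP exp_n2).
have [m em] := n1_mul_cyclic g3 ord_g2.
have [y [s [y_lt ey]]] := int_mod_nat (- m) (ltnW N_gt1).
have Ry : rel 0 (n1 * y)%N n1.
  have Rm : rel 0 (- (n1%:Z * m)) n1.
    by rewrite /rel /is_relation mulr0z add0r em mulrNz addNr.
  by apply: (relation_lin (c := - s) Rm R2); rewrite -?mulrN ?ey ?n2E ?PoszM; ring.
have Py : P 0 (n1 * y)%N n1 by apply: relation_zero1.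
case: y => [|y] in y_lt ey Ry Py *.
  by move: Ry; rewrite muln0 /rel /is_relation !mulr0z !add0r -pmulrn.
(* The residue is now [y.+1], so [y] is one less than before the case split: n1 g3 = - (y + 1) n1
   g2. *)
exfalso; have {}b0E : (b0 + 1 = N)%N by lia.
have Py2 : P 0 ((n1 * y.+1)%N%:Z - n2%:Z) n1.
  by apply: (separates_short_lin sepP (c := -1) Py P2); ring.
have Ry2 : rel 0 ((n1 * y.+1)%N%:Z - n2%:Z) n1.
  by apply: (relation_lin (c := -1) Ry R2); ring.
have eA : (r2 + n1 * y)%N = (r2 + n1 * b0)%N%:Z + ((n1 * y.+1)%N%:Z - n2%:Z) :> int.
  by rewrite n2E -b0E -(addn1 y) ?PoszD ?PoszM ?PoszD; ring.
have RA : rel r1 (r2 + n1 * y)%N (t + n1)%N.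
  by apply: (relation_lin (c := 1) Rx Ry2); rewrite ?eA ?PoszD ?PoszM; ring.
have nPA : ~ P r1 (r2 + n1 * y)%N (t + n1)%N.
  move=> PA; apply: nPx.
  by apply: (separates_short_lin sepP (c := -1) PA Py2); rewrite ?eA ?PoszD ?PoszM; ring.
(* The sum of (n1, - n1, 0), (0, n1 (y + 1), n1) and (0, n2, 0); subtracting the representative with
   a = 0 from it gives a second relation outside [P]. *)
have PZ : P n1 ((n1 * y)%N%:Z + n2%:Z) n1.
  have Pz : P n1 ((n1 * y)%N) n1.
    by apply: (separates_short_lin sepP (c := 1) P11 Py); rewrite -?(addn1 y) ?PoszM ?PoszD; ring.
  by apply: (separates_short_lin sepP (c := 1) Pz P2); ring.
have RZ : rel n1 ((n1 * y)%N%:Z + n2%:Z) n1.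
  have Rz : rel n1 ((n1 * y)%N) n1.
    by apply: (relation_lin (c := 1) R11 Ry); rewrite -?(addn1 y) ?PoszM ?PoszD; ring.
  by apply: (relation_lin (c := 1) Rz R2); ring.
have e1 : (n1 - r1)%N%:Z = n1%:Z - r1%:Z by lia.
have e2 : (n1 - r2 + n1 * y)%N%:Z = ((n1 * y)%N%:Z + n2%:Z) - (r2 + n1 * b0)%N%:Z.
  by rewrite n2E -b0E PoszD (_ : (n1 - r2)%N%:Z = n1%:Z - r2%:Z) ?PoszD ?PoszM ?PoszD; [ring | lia].
have e3 : (n1 - t)%N%:Z = n1%:Z - t%:Z by lia.
have RB : rel (n1 - r1)%N (n1 - r2 + n1 * y)%N (n1 - t)%N.
  by apply: (relation_lin (c := -1) RZ Rx); rewrite ?e1 ?e2 ?e3 ?muln0 ?addn0; ring.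
have nPB : ~ P (n1 - r1)%N (n1 - r2 + n1 * y)%N (n1 - t)%N.
  move=> PB; apply: nPx.
  by apply: (separates_short_lin sepP (c := -1) PZ PB); rewrite ?e1 ?e2 ?e3 ?muln0 ?addn0; ring.
(* The two lengths add up to 2 n1 (y + 2) <= 2 n1 N = 2 n2, so they cannot both reach D. *)
have := separates_short_long sepP RA nPA.
have := separates_short_long sepP RB nPB.
have : (n1 * y.+1 <= n1 * b0)%N by rewrite leq_pmul2l //; lia.
by have := n2_lt_D; rewrite mulnS n2E -b0E mulnDl; lia.
Qed.

End MaximalOrders.

Lemma separates_short_orders (G : finZmodType) (D : nat) (g1 g2 g3 : G) P n1 n2 :
  separates_short D g1 g2 g3 P ->
  (1 < n1)%N -> (n1 %| n2)%N -> (0 < n2)%N -> #|G| = (n1 * n2)%N ->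
  (forall g : G, g *+ n2 = 0) ->
  (forall g h : G, #[g]%g = n2 -> exists m : int, h *~ n1 = g *~ (n1%:Z * m)) ->
  (n2 + n1 %/ pdiv n1 <= D)%N ->
  exists h1 h2 h3 : G,
    [/\ #[h1]%g = n2, #[h2]%g = n2, #[h3]%g = n1,
        [set g1; g2; g3] = [set h1; h2; h3] &
        [/\ h1 \notin <[h2]>%g /\ h2 \notin <[h1]>%g,
            h1 \notin <[h3]>%g /\ h3 \notin <[h1]>%g &
            h2 \notin <[h3]>%g /\ h3 \notin <[h2]>%g]].
Proof.
move=> sepP n1_gt1 n1n2 n2_gt0 cardG exp_n2 cyc D_ge.
have n1p_gt0 : (0 < n1 %/ pdiv n1)%N.
  by rewrite divn_gt0 ?pdiv_gt0 // dvdn_leq ?pdiv_dvd // ltnW.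
have n2_lt_D : (n2 < D)%N by apply: leq_trans D_ge; rewrite -[ltnLHS]addn0 ltn_add2l.
have o3_dvd (h1 h2 h3 : G) Q : separates_short D h1 h2 h3 Q ->
    #[h1]%g = n2 -> #[h2]%g = n2 -> h2 \notin <[h1]>%g -> (#[h3]%g %| n1)%N.
  move=> sQ o1 o2 h21; rewrite order_dvdn zmodXgE.
  by rewrite (n1_mul_g3_eq0 sQ exp_n2 n2_gt0 n2_lt_D n1_gt1 n1n2 cardG o1 o2 D_ge cyc h21).
have n1E := divnK (pdiv_dvd n1).
have p_min m := @pdiv_min_dvd n1 m.
move: (pdiv n1) (n1 %/ pdiv n1)%N n1p_gt0 n1E p_min D_ge => p q q_gt0 n1E p_min D_ge.
(* With at most one order equal to n2, the sum would be at most n2 + 2 (n2/2) < 2 D. Rotations bring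
   two elements of order n2 to the front. *)
wlog [o1 o2] : g1 g2 g3 P sepP / #[g1]%g = n2 /\ #[g2]%g = n2.
  have half (g : G) : #[g]%g = n2 \/ (2 * #[g]%g <= n2)%N.
    have /dvdnP[m e] : (#[g]%g %| n2)%N by rewrite order_dvdn zmodXgE exp_n2.
    by case: m e => [|[|m]] e; [lia | left; lia | right; nia].
  have sum := sum_orders_ge sepP exp_n2 n2_gt0 n2_lt_D.
  have s2 := separates_short_rot sepP; have s3 := separates_short_rot s2.
  move=> wl; have [o1|o1] := half g1; have [o2|o2] := half g2; last by case: (half g3); lia.
  - exact: wl sepP _.
  - have o3 : #[g3]%g = n2 by case: (half g3); lia.
    have [h1 [h2 [h3 [a b c d e]]]] := wl _ _ _ _ s3 (conj o3 o1).
    by exists h1, h2, h3; split=> //; rewrite -d; apply/setP=> x; rewrite !inE;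
      do 3 case: (x == _).
  - have o3 : #[g3]%g = n2 by case: (half g3); lia.
    have [h1 [h2 [h3 [a b c d e]]]] := wl _ _ _ _ s2 (conj o2 o3).
    by exists h1, h2, h3; split=> //; rewrite -d; apply/setP=> x; rewrite !inE;
      do 3 case: (x == _).
have notin (h1 h2 h3 : G) Q : separates_short D h1 h2 h3 Q ->
    h1 \notin <[h2]>%g /\ h2 \notin <[h1]>%g.
  move=> sQ; split; first exact: notin_cycle12 sQ _ exp_n2 n2_gt0 n2_lt_D.
  exact: notin_cycle12 (separates_short_swap sQ) _ exp_n2 n2_gt0 n2_lt_D.
exists g1, g2, g3; split=> //; last first.
  split; first exact: notin sepP.
    by have [] := notin _ _ _ _ (separates_short_rot (separates_short_rot sepP)).
  by have [] := notin _ _ _ _ (separates_short_rot sepP).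
have [_ g21] := notin _ _ _ _ sepP.
have /dvdnP[m e] := o3_dvd _ _ _ _ sepP o1 o2 g21.
have := sum_orders_ge sepP exp_n2 n2_gt0 n2_lt_D; rewrite o1 o2 => sum.
suff m1 : m = 1%N by rewrite e m1 mul1n.
(* If m > 1, then m >= p, while the sum of the orders gives #[g3] >= 2 q; hence n1 = m #[g3] >= 2 p
   q = 2 n1. *)
have [m_gt1 | m_le1] := ltnP 1 m; last by case: m e m_le1 => [|[|]] //; lia.
have p_le : (p <= m)%N by apply: p_min; rewrite // e dvdn_mulr.
have o3_ge : (2 * q <= #[g3]%g)%N by lia.
have : (2 * q * p <= #[g3]%g * m)%N by apply: leq_mul.
by rewrite -mulnA n1E [(_ * m)%N]mulnC -e; lia.
Qed.

(** * From sequences to relations *)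

Section Factorization.
Variable G : finZmodType.
Implicit Types (S T : sequence G) (X : {set G}).

(** Truncated: this is the complement of [T] in [S] only if [T] is a subsequence. *)
Definition seq_sub S T : sequence G := [ffun g => (S g - T g)%N].

Lemma seq_subK S T : subsequence T S -> T + seq_sub S T = S.
Proof. by move=> TS; apply/ffunP=> g; rewrite !ffunE /= -[RHS](subnKC (TS g)). Qed.

Lemma seq_lengthD S T : seq_length (S + T) = (seq_length S + seq_length T)%N.
Proof. by rewrite /seq_length -big_split; apply: eq_bigr => g _; rewrite ffunE. Qed.

Lemma seq_sumD S T : seq_sum (S + T) = seq_sum S + seq_sum T.
Proof.
by rewrite /seq_sum -big_split; apply: eq_bigr => g _; rewrite ffunE mulrnDr.
Qed.

Lemma seq_length_eq0 S : seq_length S = 0%N -> S = 0.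
Proof.
move=> /eqP; rewrite sum_nat_eq0 => /forallP S0.
by apply/ffunP=> g; rewrite ffunE; apply/eqP; apply: S0.
Qed.

Lemma subsequence_length S T : subsequence T S -> (seq_length T <= seq_length S)%N.
Proof. by move=> TS; apply: leq_sum. Qed.

Lemma zero_sum_subsequence X S T :
  zero_sum X S -> subsequence T S -> seq_sum T = 0 -> zero_sum X T.
Proof.
case=> SX _ TS T0; split=> //; apply: subset_trans SX.
by apply/subsetP=> g; rewrite !inE -!lt0n => /leq_trans; apply.
Qed.

(** Induction on the length: either [S] is an atom, or it has a proper nontrivial zero-sum
    subsequence, which is strictly shorter. *)
Lemma exists_atom_subsequence X S : zero_sum X S -> S <> 0 ->
  exists2 T, subsequence T S & atom X T.
Proof.
have [l] := ubnP (seq_length S); elim: l S => // l IH S.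
rewrite ltnS => lS zS S0.
have [|nex] := EM (exists T, [/\ subsequence T S, zero_sum X T, T <> 0 & T <> S]).
  case=> T [TS zT T0 TnS]; have lT : (seq_length T < l)%N.
    apply: leq_trans lS; rewrite ltn_neqAle subsequence_length // andbT.
    apply/eqP => e; apply: TnS.
    have : seq_length (seq_sub S T) = 0%N.
      by have := seq_lengthD T (seq_sub S T); rewrite seq_subK // e; lia.
    by move/seq_length_eq0 => z; rewrite -(seq_subK TS) z addr0.
  have [U UT aU] := IH T lT zT T0; exists U => // g; exact: leq_trans (UT g) (TS g).
exists S; first by move=> g.
split=> // T TS zT T0; apply: contrapT => TnS.
by apply: nex; exists T.
Qed.

(** Split off an atom and induct on the rest; no atom met is longer than [S]. *)
Lemma zero_sum_upto_short X l S :
  zero_sum X S -> (seq_length S <= l)%N -> zero_sum_upto X l S.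
Proof.
have [m] := ubnP (seq_length S); elim: m S => // m IH S.
rewrite ltnS => mS zS lS.
have [->|/eqP S0] := eqVneq S 0; first exact: submonoid_gen0.
have [T TS aT] := exists_atom_subsequence zS S0.
have := seq_lengthD T (seq_sub S T); rewrite seq_subK // => e.
have T_gt0 : (0 < seq_length T)%N.
  by rewrite lt0n; apply/eqP => /seq_length_eq0; case: aT.
rewrite -(seq_subK TS); apply: submonoid_genD.
  by apply: submonoid_gen_base; split=> //; lia.
apply: IH; try lia; apply: (zero_sum_subsequence zS).
  by move=> g; rewrite ffunE leq_subr.
case: zS => _; rewrite -{1}(seq_subK TS) seq_sumD.
by case: aT => -[_ ->] _ _; rewrite add0r.
Qed.

End Factorization.

(** * Sequences supported on at most three elements *)

Section Triples.
Variable G : finZmodType.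
Variables g1 g2 g3 : G.

(** A sum of indicators, so that it stays additive when some of the [g1], [g2], [g3] coincide. *)
Definition triple_vec (i j k : int) : {ffun G -> int} :=
  [ffun g => i *+ (g == g1) + j *+ (g == g2) + k *+ (g == g3)].

Definition triple_seq (i j k : nat) : sequence G :=
  [ffun g => i * (g == g1) + j * (g == g2) + k * (g == g3)]%N.

Lemma triple_seq_to_int (i j k : nat) :
  seq_to_int (triple_seq i j k) = triple_vec i j k.
Proof.
apply/ffunP=> g; rewrite !ffunE.
by do 3 case: (g == _); rewrite /= ?mulr1n ?mulr0n; lia.
Qed.

Lemma triple_seq_length i j k : seq_length (triple_seq i j k) = (i + j + k)%N.
Proof.
rewrite /seq_length; under eq_bigr => g _ do rewrite ffunE.
rewrite !big_split /= -!big_distrr /=.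
have one (h : G) : (\sum_(g : G) (g == h) = 1)%N by rewrite -big_mkcond /= big_pred1_eq.
by rewrite !one !muln1.
Qed.

Lemma triple_seq_sum i j k :
  seq_sum (triple_seq i j k) = g1 *+ i + g2 *+ j + g3 *+ k.
Proof.
have one (h : G) m : \sum_(g : G) g *+ (m * (g == h)) = h *+ m.
  rewrite (bigD1 h) //= eqxx muln1 big1 ?addr0 // => g /negPf ->.
  by rewrite muln0.
rewrite /seq_sum -!one -!big_split /=; apply: eq_bigr => g _.
by rewrite ffunE !mulrnDr.
Qed.

Lemma triple_seq_supp i j k : seq_supp (triple_seq i j k) \subset [set g1; g2; g3].
Proof.
apply/subsetP=> g; rewrite !inE ffunE.
by case: (g == g1); case: (g == g2); case: (g == g3); rewrite // !muln0.
Qed.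

Lemma triple_seqE S : seq_supp S = [set g1; g2; g3] ->
  exists i j k, S = triple_seq i j k.
Proof.
(* A repeated element gets its whole multiplicity at its first occurrence and 0 afterwards. *)
move=> SE; exists (S g1), (S g2 * (g2 != g1))%N, (S g3 * ((g3 != g1) && (g3 != g2)))%N.
apply/ffunP=> g; rewrite ffunE.
have [->|g_n1] := eqVneq g g1.
  rewrite !(eq_sym g1); case: (g2 == g1); case: (g3 == g1) => /=;
  by rewrite ?(muln0, muln1, mul0n, addn0).
have [eg|g_n2] := eqVneq g g2.
  rewrite -eg g_n1 (eq_sym g g3); case: (g3 == g) => /=;
  by rewrite ?andbF ?(muln0, muln1, mul0n, addn0, add0n).
have [eg|g_n3] := eqVneq g g3.
  by rewrite -eg g_n1 g_n2 /= ?(muln0, muln1, mul0n, addn0, add0n).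
rewrite !muln0; apply/eqP; apply: contraTT isT => Sg.
have : g \in seq_supp S by rewrite inE.
by rewrite SE !inE (negPf g_n1) (negPf g_n2) (negPf g_n3).
Qed.

(** A relation with natural coordinates and length below |A| is a zero-sum sequence of length at
    most |A| - 1, and [A] itself supplies the relation outside. *)
Lemma separating_atom_separates_short A :
  separating_atom A -> seq_supp A = [set g1; g2; g3] ->
  separates_short (seq_length A) g1 g2 g3 (fun i j k =>
    Defs.quotient_group (zero_sum_upto (seq_supp A) (seq_length A).-1)
      (triple_vec i j k)).
Proof.
move=> [[[_ A0] _ _] sepA] suppA; split=> [i j k i' j' k' P P'|i j k r lt|].
- suff -> : triple_vec (i - i') (j - j') (k - k') =
      triple_vec i j k - triple_vec i' j' k' by apply: Defs.quotient_groupB.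
  apply/ffunP=> g; rewrite !ffunE.
  by do 3 case: (g == _); rewrite /= ?mulr1n ?mulr0n; lia.
- rewrite -triple_seq_to_int; apply: Defs.quotient_group_base.
  apply: zero_sum_upto_short; last by rewrite triple_seq_length; lia.
  by split; [rewrite suppA triple_seq_supp | rewrite triple_seq_sum].
have [i [j [k AE]]] := triple_seqE suppA; exists i, j, k; split.
  by rewrite /is_relation -A0 [in RHS]AE triple_seq_sum.
by rewrite -triple_seq_to_int -AE.
Qed.

End Triples.

Lemma set_card_le3 (T : finType) (X : {set T}) : X != set0 -> (#|X| <= 3)%N ->
  exists a b c, X = [set a; b; c].
Proof.
rewrite -card_gt0 cardE => X0 X3.
have XE : X = [set x in enum X] by apply/setP=> x; rewrite !inE mem_enum.
case: (enum X) X0 X3 XE => [|a [|b [|c []]]] // _ _ ->.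
- by exists a, a, a; apply/setP=> x; rewrite !inE !orbb.
- by exists a, b, b; apply/setP=> x; rewrite !inE -orbA orbb.
- by exists a, b, c; apply/setP=> x; rewrite !inE orbA.
Qed.

(** * The lower bound for the separating Noether number *)

(** X^n - 1 splits and is separable, so it has n distinct roots, one of which is primitive. *)
Lemma primitive_root_exists (F : closedFieldType) n : (n%:R != 0 :> F) ->
  exists z : F, n.-primitive_root z.
Proof.
move=> n0; have n_gt0 : (0 < n)%N by rewrite lt0n; apply: contraNneq n0 => ->.
have [rs def] := closed_field_poly_normal ('X^n - 1 : {poly F}).
rewrite (monicP _) ?monicXnsubC // scale1r in def.
have size_rs : size rs = n.
  by have := size_XnsubC (1 : F) n_gt0; rewrite def size_prod_XsubC => -[].
have rs_root : all n.-unity_root rs.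
  by apply/allP=> z zrs; rewrite /root_of_unity def root_prod_XsubC.
have rs_uniq : uniq rs by rewrite -separable_prod_XsubC -def separable_Xn_sub_1.
have /hasP[z _ z_prim] : has n.-primitive_root rs.
  by apply: has_prim_root; rewrite ?size_rs.
by exists z.
Qed.

Lemma val_Zp_add n (a b : 'Z_n) : (1 < n)%N -> val (a + b) = ((val a + val b) %% n)%N.
Proof.
move=> n_gt1; transitivity ((val a + val b) %% (Zp_trunc n).+2)%N => //.
by congr (_ %% _)%N; apply: Zp_cast.
Qed.

(** * Exponent, multiples of n1 and coordinates in the group of rank two *)

Section Isog.
Variables (n1 n2 : nat) (G : finZmodType).
Hypothesis n1_gt1 : (1 < n1)%N.
Hypothesis n2_gt0 : (0 < n2)%N.
Hypothesis n1n2 : (n1 %| n2)%N.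
Hypothesis isoG : ([set: G] \isog [set: 'Z_n1 * 'Z_n2])%g.

Lemma isog_card : #|G| = (n1 * n2)%N.
Proof.
have n2_gt1 : (1 < n2)%N := leq_trans n1_gt1 (dvdn_leq n2_gt0 n1n2).
by rewrite -cardsT (card_isog isoG) cardsT card_prod !card_ord !Zp_cast.
Qed.

Lemma isog_additive : exists f : G -> 'Z_n1 * 'Z_n2,
  [/\ {morph f : x y / x + y}, injective f & forall y, exists x, f x = y].
Proof.
have [f injf imf] := isogP isoG; exists f; split.
- by move=> x y; apply: (morphM f); rewrite inE.
- by move=> x y; apply: (injmP injf); rewrite inE.
- move=> y; have : y \in (f @* [set: G])%g by rewrite imf inE.
  by case/morphimP=> x _ _ ->; exists x.
Qed.

Lemma isog_mulrn (f : G -> 'Z_n1 * 'Z_n2) : {morph f : x y / x + y} ->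
  forall g n, f (g *+ n) = ((f g).1 *+ n, (f g).2 *+ n).
Proof.
move=> fD g; elim=> [|n IH]; last by rewrite !mulrS fD IH.
by apply: (addrI (f 0)); rewrite !mulr0n -fD addr0 -[LHS]addr0.
Qed.

Lemma natr_Zp_eq0 n (m : nat) : (1 < n)%N -> (n %| m)%N -> m%:R = 0 :> 'Z_n.
Proof. by move=> n_gt1 /dvdnP[k ->]; rewrite natrM pchar_Zp // mulr0. Qed.

Lemma isog_exponent (g : G) : g *+ n2 = 0.
Proof.
have n2_gt1 : (1 < n2)%N := leq_trans n1_gt1 (dvdn_leq n2_gt0 n1n2).
have [f [fD f_inj _]] := isog_additive; apply: f_inj.
rewrite -(mulr0n g) !isog_mulrn // -(mulr_natr (f g).1) -(mulr_natr (f g).2).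
by rewrite !natr_Zp_eq0 // !mulr0.
Qed.

(** Multiplication by n1 kills the first coordinate, so n1 G is generated by n1 e, where e = (0, 1),
    and its order divides n2/n1. As n1 g has order n2/n1, it generates n1 G too. *)
Lemma isog_mul_cyclic (g h : G) : #[g]%g = n2 ->
  exists m : int, h *~ n1 = g *~ (n1%:Z * m).
Proof.
have n2_gt1 : (1 < n2)%N := leq_trans n1_gt1 (dvdn_leq n2_gt0 n1n2).
have [f [fD f_inj f_surj]] := isog_additive; have [e ee] := f_surj (0, 1).
have n1_mul x : (x *+ n1 \in <[e *+ n1]>)%g.
  apply/cycleP; exists (val (f x).2); rewrite zmodXgE -mulrnA; apply: f_inj.
  rewrite !isog_mulrn // ee /= mul0rn -mulr_natr natr_Zp_eq0 // mulr0.
  by rewrite mulnC mulrnA -[1 *+ _]/(_%:R) natr_Zp.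
move=> og; have n1_gt0 := ltnW n1_gt1.
have : <[g *+ n1]>%g = <[e *+ n1]>%g.
  apply/eqP; rewrite eqEcard cycle_subG n1_mul -!orderE.
  have -> : #[g *+ n1]%g = (n2 %/ n1)%N by rewrite -zmodXgE orderXgcd og (gcdn_idPr n1n2).
  apply: dvdn_leq; first by rewrite divn_gt0 // dvdn_leq.
  by rewrite order_dvdn zmodXgE -mulrnA mulnC divnK // isog_exponent.
move=> ge; have := n1_mul h; rewrite -ge => /cycleP[m].
rewrite zmodXgE -mulrnA => hm; exists m%:Z.
by rewrite -PoszM -!pmulrn.
Qed.

(** The coordinates are natural numbers, additive only modulo n1 and n2, so that they can serve as
    exponents of roots of unity. *)
Lemma isog_coordinates : exists c1 c2 : G -> nat,
  [/\ forall x y, c1 (x + y) = c1 x + c1 y %[mod n1],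
      forall x y, c2 (x + y) = c2 x + c2 y %[mod n2],
      exists e, c1 e = 1%N /\ c2 e = 0%N &
      exists e, c1 e = 0%N /\ c2 e = 1%N].
Proof.
have n2_gt1 : (1 < n2)%N := leq_trans n1_gt1 (dvdn_leq n2_gt0 n1n2).
have [f [fD _ f_surj]] := isog_additive.
exists (fun x => val (f x).1), (fun x => val (f x).2); split.
- by move=> x y; rewrite fD val_Zp_add // modn_mod.
- by move=> x y; rewrite fD val_Zp_add // modn_mod.
- by have [e ee] := f_surj (1, 0); exists e; rewrite ee.
- by have [e ee] := f_surj (0, 1); exists e; rewrite ee.
Qed.

End Isog.

(** * Invariants of a diagonal representation *)

Section Diagonal.
Variables (R : realType) (G : finZmodType) (n : nat).
Variable chi : 'I_n -> G -> R[i].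
Hypothesis chi0 : forall i, chi i 0 = 1.
Hypothesis chiD : forall i g h, chi i (g + h) = chi i g * chi i h.

Lemma diag_mx_repr : mx_repr [set: G] (fun g => diag_mx (\row_i chi i g)).
Proof.
split=> [|g h _ _].
  by apply/matrixP=> i j; rewrite !mxE; case: eqP => // ->; rewrite chi0.
by rewrite mulmx_diag; congr diag_mx; apply/rowP=> i; rewrite !mxE chiD.
Qed.

Definition diag_representation := MxRepresentation diag_mx_repr.

(** Averaging [f] over the group multiplies each monomial by a character sum, which vanishes unless
    the monomial is invariant; so only the invariant monomials of [f] contribute to its values. *)
Lemma invariant_eq (f : {mpoly R[i][n]}) (v1 v2 : 'cV[R[i]]_n) :
  Defs.invariant diag_representation f ->
  (forall m : 'X_{1..n}, m \in msupp f ->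
     (forall g, \prod_i chi i g ^+ m i = 1) ->
     \prod_i v1 i 0 ^+ m i = \prod_i v2 i 0 ^+ m i) ->
  poly_eval f v1 = poly_eval f v2.
Proof.
move=> inv_f v12.
have G0 : #|G|%:R != 0 :> R[i].
  by rewrite pnatr_eq0 -lt0n; apply/card_gt0P; exists 0.
apply: (mulfI G0).
have average v : #|G|%:R * poly_eval f v =
    \sum_(m <- msupp f) f@_m * (\sum_(g : G) \prod_i chi i (- g) ^+ m i) * \prod_i v i 0 ^+ m i.
  transitivity (\sum_(g : G) poly_eval f v).
    by rewrite sumr_const mulr_natl.
  under eq_bigr => g _.
    rewrite -(inv_f g v) /poly_eval mevalE.
    under eq_bigr => m _.
      under eq_bigr => i _ do rewrite mul_diag_mx !mxE exprMn.
      rewrite big_split /= mulrA.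
    over.
  over.
  rewrite exchange_big /=; apply: eq_bigr => m _.
  by rewrite -mulr_suml -mulr_sumr.
rewrite !average; apply: eq_big_seq => m fm.
have [/forallP inv_m|] := boolP [forall g, \prod_i chi i g ^+ m i == 1].
  by rewrite (v12 m fm) // => g; apply/eqP/inv_m.
case/forallPn => h h_neq1.
suff -> : \sum_(g : G) \prod_i chi i (- g) ^+ m i = 0 by rewrite mulr0 !mul0r.
(* Translating the summation variable by -h multiplies the sum by a factor different from 1. *)
set s := LHS; have : s = \prod_i chi i h ^+ m i * s.
  rewrite /s [LHS](reindex_inj (addIr (- h))) /= mulr_sumr; apply: eq_bigr => g _.
  rewrite -big_split /=; apply: eq_bigr => i _.
  by rewrite opprD opprK chiD exprMn mulrC.
move/eqP; rewrite -subr_eq0 -{1}[s]mul1r -mulrBl mulf_eq0 subr_eq0 eq_sym.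
by rewrite (negPf h_neq1) /= => /eqP.
Qed.

End Diagonal.

(** With n1 = q p, q divides n1 and n1 - q = q (p - 1), hence y2. If y2 = 0, then p divides (p - 1)
    z, hence z. Otherwise y2 >= q, so y1 + z < n2 is a multiple of n2, and z = 0. *)
Lemma dvdn_short_monomial (n1 n2 p y1 y2 z : nat) :
  (0 < n1)%N -> prime p -> (p %| n1)%N ->
  (n2 %| y1 + z)%N -> (n1 %| y2 + (n1 - n1 %/ p) * z)%N ->
  (y1 + y2 + z < n2 + n1 %/ p)%N -> (p %| z)%N.
Proof.
move=> n1_gt0 p_prime p_dvd; have n1E := divnK p_dvd.
move: (n1 %/ p)%N n1E => q n1E d2 d1 lt.
have q_gt0 : (0 < q)%N by case: q n1E {lt d1} => //; lia.
have sE : (n1 - q)%N = (q * p.-1)%N by rewrite -n1E -subn1 mulnBr muln1.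
have q_dvd : (q %| n1)%N by rewrite -n1E dvdn_mulr.
have /dvdnP[w y2E] : (q %| y2)%N.
  by have := dvdn_trans q_dvd d1; rewrite dvdn_addl // sE -mulnA dvdn_mulr.
have : (q * p %| q * (w + p.-1 * z))%N.
  by rewrite n1E mulnDr mulnA -sE [(q * w)%N]mulnC -y2E.
rewrite dvdn_pmul2l //.
case: w y2E => [|w] y2E.
  rewrite add0n Gauss_dvdr // -[X in coprime X _](prednK (prime_gt0 p_prime)).
  by rewrite coprimeSn.
have : (y1 + z < n2)%N.
  by rewrite -(ltn_add2r q); apply: leq_trans lt; rewrite ltnS y2E mulSn; lia.
case: (posnP (y1 + z)) => [|yz_gt0]; last by move/gtnNdvd => /(_ yz_gt0); rewrite d2.
by move=> e _ _; rewrite (_ : z = 0)%N //; lia.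
Qed.

Lemma beta_sep_bound_ge (R : realType) (n1 n2 : nat) (G : finZmodType) (m : nat) :
  (1 < n1)%N -> (0 < n2)%N -> (n1 %| n2)%N ->
  ([set: G] \isog [set: 'Z_n1 * 'Z_n2])%g ->
  beta_sep_bound R G m -> (n2 + n1 %/ pdiv n1 <= m)%N.
Proof.
move=> n1_gt1 n2_gt0 n1n2 isoG bound.
have n1_gt0 := ltnW n1_gt1; have p_prime := pdiv_prime n1_gt1.
have [c1 [c2 [c1D c2D [e1 [c1e1 c2e1]] [e2 [c1e2 c2e2]]]]] :=
  isog_coordinates n1_gt1 n2_gt0 n1n2 isoG.
set q := (n1 %/ pdiv n1)%N.
have prim n : (0 < n)%N -> exists z : R[i], n.-primitive_root z.
  by move=> n_gt0; apply: primitive_root_exists; rewrite pnatr_eq0 -lt0n.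
have [z1 z1P] := prim _ n1_gt0; have [z2 z2P] := prim _ n2_gt0.
have [w wP] := prim _ (prime_gt0 p_prime).
have powD n (z : R[i]) (c : G -> nat) : n.-primitive_root z ->
    (forall x y, c (x + y) = c x + c y %[mod n]) ->
    forall x y, z ^+ c (x + y) = z ^+ c x * z ^+ c y.
  move=> zP cD x y; rewrite -exprD; apply/eqP.
  by rewrite (eq_prim_root_expr zP); apply/eqP/cD.
(* Exponents of the three characters in the two coordinates; the coefficient -q is represented by n1
   - q. *)
pose a (i : 'I_3) := nth 0%N [:: 0; 1; n1 - q]%N i.
pose b (i : 'I_3) := nth 0%N [:: 1; 0; 1]%N i.
pose chi (i : 'I_3) (g : G) : R[i] := (z1 ^+ c1 g) ^+ a i * (z2 ^+ c2 g) ^+ b i.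
have chiD i g h : chi i (g + h) = chi i g * chi i h.
  by rewrite /chi (powD _ _ _ z1P c1D) (powD _ _ _ z2P c2D) !exprMn mulrACA.
(* The coordinates of 0 are only known through congruences; but [chi i 0] is a nonzero
   idempotent. *)
have chi0 i : chi i 0 = 1.
  have neq0 n (z : R[i]) k : n.-primitive_root z -> z ^+ k != 0.
    move=> zP; rewrite expf_neq0 //; apply/eqP => z0.
    have := prim_expr_order zP; rewrite z0 expr0n gtn_eqF ?(prim_order_gt0 zP) //.
    by move/eqP; rewrite eq_sym oner_eq0.
  have chi_neq0 : chi i 0 != 0.
    by apply: mulf_neq0; apply: expf_neq0; [apply: neq0 z1P | apply: neq0 z2P].
  by apply: (mulfI chi_neq0); rewrite -chiD addr0 mulr1.
have [d [[_ [F [[Finv Fsep] Fhom]] _] d_le]] := bound 3 (diag_representation chi0 chiD).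
pose v1 : 'cV[R[i]]_3 := const_mx 1.
pose v2 : 'cV[R[i]]_3 := \col_i w ^+ (i == 2 :> nat).
pose i1 : 'I_3 := lift ord0 ord0; pose i2 : 'I_3 := lift ord0 (lift ord0 ord0).
have prod3 (phi : 'I_3 -> R[i]) : \prod_i phi i = phi ord0 * phi i1 * phi i2.
  by rewrite !big_ord_recl big_ord0 mulr1 mulrA; congr (_ * _ * phi _); apply: val_inj.
have sum3 (phi : 'I_3 -> nat) : (\sum_i phi i = phi ord0 + phi i1 + phi i2)%N.
  by rewrite !big_ord_recl big_ord0 addn0 addnA; congr (_ + _ + phi _)%N; apply: val_inj.
have prod_chi g (y : 'I_3 -> nat) : \prod_i chi i g ^+ y i =
    z1 ^+ (c1 g * (y i1 + (n1 - q) * y i2)) * z2 ^+ (c2 g * (y ord0 + y i2)).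
  rewrite prod3 /chi /a /b !exprM /=; move: (z1 ^+ c1 g) (z2 ^+ c2 g) => u1 u2.
  rewrite !expr0 !expr1 mul1r mulr1 !exprMn !exprD exprM.
  move: (u1 ^+ _) (_ ^+ y i2) (u2 ^+ _) (u2 ^+ _) => x1 x2 x3 x4; ring.
have prod_v1 (y : 'I_3 -> nat) : \prod_i v1 i 0 ^+ y i = 1.
  by rewrite big1 // => i _; rewrite mxE expr1n.
have prod_v2 (y : 'I_3 -> nat) : \prod_i v2 i 0 ^+ y i = w ^+ y i2.
  by rewrite prod3 !mxE /= !expr0 !expr1n !mul1r.
have [|f [Ff f_neq]] := Fsep v1 v2.
  (* The monomial is invariant because its exponents give q + (n1 - q) = n1 and (n2 - 1) + 1 = n2;
     its values at the two points are 1 and w. *)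
  pose M := [multinom nth 0%N [:: n2.-1; q; 1]%N i | i < 3].
  have evalM v : poly_eval 'X_[M] v = \prod_i v i 0 ^+ M i by rewrite /poly_eval mevalX.
  exists 'X_[M]; split=> [g v|].
    rewrite !evalM; under eq_bigr => i _ do rewrite mul_diag_mx !mxE exprMn.
    rewrite big_split /= prod_chi !mnmE /= muln1 subnKC ?leq_div //.
    rewrite addn1 prednK // (mulnC (c1 _)) (mulnC (c2 _)) !exprM.
    by rewrite (prim_expr_order z1P) (prim_expr_order z2P) !expr1n !mul1r.
  rewrite !evalM prod_v1 prod_v2 mnmE /= expr1 => /eqP.
  rewrite eq_sym -[w]expr1 -(prim_order_dvd wP) dvdn1 => /eqP p1.
  by move: p_prime; rewrite p1.
have [k [k_le /dhomogP f_homog]] := Fhom f Ff.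
(* If m < n2 + q, every invariant monomial of [f] has third exponent divisible by p, so [f] cannot
   tell the two points apart. *)
rewrite leqNgt; apply/negP => m_lt; apply: f_neq.
apply: (invariant_eq (Finv f Ff)) => y fy chi_y.
rewrite prod_v1 prod_v2; apply/esym/eqP; rewrite -(prim_order_dvd wP).
have yk : (y ord0 + y i1 + y i2 = k)%N by rewrite -sum3 -mdegE; apply: f_homog.
apply: (dvdn_short_monomial (y1 := y ord0) (y2 := y i1) n1_gt0 p_prime (pdiv_dvd n1)).
(* Invariance under e2 and under e1 gives the two divisibility conditions, by n2 and by n1. *)
- have := chi_y e2; rewrite prod_chi c1e2 c2e2 mul0n mul1n expr0 mul1r => /eqP.
  by rewrite -(prim_order_dvd z2P); apply.
- have := chi_y e1; rewrite prod_chi c1e1 c2e1 mul0n mul1n expr0 mulr1 => /eqP.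
  by rewrite -(prim_order_dvd z1P); apply.
by rewrite yk; apply: leq_ltn_trans m_lt; apply: leq_trans d_le.
Qed.

Theorem theorem1p5 (R : realType) (n1 n2 : nat) (G : finZmodType)
    (hn1 : (1 < n1)%N) (hn2 : (0 < n2)%N) (hdvd : (n1 %| n2)%N)
    (hG : ([set: G] \isog [set: 'Z_n1 * 'Z_n2])%g)
    (A : sequence G)
    (hA : separating_atom A)
    (hlen : is_beta_sep R G (seq_length A))
    (hsupp : (#|seq_supp A| <= 3)%N) :
  exists g1 g2 g3 : G,
    [/\ #[g1]%g = n2, #[g2]%g = n2, #[g3]%g = n1,
        seq_supp A = [set g1; g2; g3] &
        [/\ g1 \notin <[g2]>%g /\ g2 \notin <[g1]>%g,
            g1 \notin <[g3]>%g /\ g3 \notin <[g1]>%g &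
            g2 \notin <[g3]>%g /\ g3 \notin <[g2]>%g]].
Proof.
have D_ge := beta_sep_bound_ge hn1 hn2 hdvd hG (proj1 hlen).
have suppA : seq_supp A != set0.
  case: hA => -[_ A_neq0 _] _; apply/eqP=> supp0; apply: A_neq0.
  apply/ffunP=> g; rewrite ffunE; apply/eqP; apply: contraTT isT => Ag.
  by have := in_set0 g; rewrite -supp0 inE Ag.
(* Repetitions among the three elements are still allowed here. *)
have [g1 [g2 [g3 suppE]]] := set_card_le3 suppA hsupp.
rewrite suppE.
apply: (separates_short_orders (separating_atom_separates_short hA suppE)) => //.
- exact: isog_card hG.
- exact: isog_exponent hG.
- exact: isog_mul_cyclic hG.
Qed.
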